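(* Let $M$ be the hyperbolic plane with a chosen origin $O$, and let $S(r)=\{x\in M:\mathrm{Dist}_M(O,x)=r\}$. There exists a time-homogeneous Markov chain $X=(X_n)_{n\in\mathbb{N}}$ on $M$ which is zero drift and transient (i.e. $\mathrm{Dist}_M(O,X_n)\to\infty$ almost surely), satisfying (A) there exist $p>2$ and $B\in\mathbb{R}$ with $\mathbb{E}[\mathrm{Dist}_M(X_n,X_{n+1})^p\mid X_n=x]\le B$ for all $x\in M$, and (B) $\limsup_{n\to\infty}\mathrm{Dist}_M(X_n,O)=\infty$ almost surely, such that, for every positive integer $N$, $$\lim_{r\to\infty}\ r^N\sup_{x\in S(r)}\mathbb{E}_x\big[d_{\rm tot}^2-d_{\rm rad}^2\big]=0.$$
   Context: The hyperbolic plane is the complete simply connected surface of constant curvature $-1$; $\exp_x:T_xM\to M$ is a diffeomorphism for each $x$, and $\mathrm{Dist}_M$ is the Riemannian distance. $X$ is zero drift if $\mathbb{E}[\exp_{X_n}^{-1}(X_{n+1})\mid\mathcal{F}_n]=0$ a.s. for all $n$, where $\mathcal{F}_n=\sigma(X_1,\dots,X_n)$ and the expectation is in the vector space $T_{X_n}M$. Put $v_n:=\exp_{X_n}^{-1}(X_{n+1})$. For $x\ne O$, $e_{\rm rad}(x)\in T_xM$ is the unit vector tangent to the geodesic from $x$ to $O$, pointing towards $O$. Put $d_{\rm tot}^n:=\|v_n\|=\mathrm{Dist}_M(X_n,X_{n+1})$, and $d_{\rm rad}^n:=-\langle v_n,e_{\rm rad}(X_n)\rangle_{X_n}$ if $X_n\ne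 O$, $d_{\rm rad}^n:=d_{\rm tot}^n$ if $X_n=O$. $\mathbb{E}_x[f(d_{\rm tot},d_{\rm rad})]$ means $\mathbb{E}[f(d^n_{\rm tot},d^n_{\rm rad})\mid X_n=x]$, which does not depend on $n$. *)

(* Defs.v *)
From HB Require Import structures.
From mathcomp Require Import all_boot all_order all_algebra.
From mathcomp Require Import all_classical all_reals all_analysis.
From mathcomp Require Import ring lra.

Set Implicit Arguments.
Unset Strict Implicit.
Unset Printing Implicit Defensive.

Import Order.TTheory GRing.Theory Num.Theory.
Import numFieldNormedType.Exports.

Local Open Scope classical_set_scope.
Local Open Scope ring_scope.

Section HyperbolicFunctions.
Context {R : realType}.

Definition cosh (t : R) : R := (expR t + expR (- t)) / 2.
Definition tanh (t : R) : R :=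
  (expR t - expR (- t)) / (expR t + expR (- t)).
Definition arcosh (t : R) : R := ln (t + Num.sqrt (t ^+ 2 - 1)).
Definition artanh (t : R) : R := ln ((1 + t) / (1 - t)) / 2.

Let eM (t : R) : expR t * expR (- t) = 1.
Proof. by rewrite expRN divff // gt_eqF ?expR_gt0. Qed.

Lemma tanh_sqr_lt1 (t : R) : tanh t ^+ 2 < 1.
Proof.
have := eM t; have := expR_gt0 t; have := expR_gt0 (- t).
rewrite /tanh; set a := expR t; set b := expR (- t) => b0 a0 ab.
rewrite expr_div_n ltr_pdivrMr ?mul1r; last by rewrite exprn_gt0 // addr_gt0.
by rewrite !expr2; nra.
Qed.

Lemma tanhN (t : R) : tanh (- t) = - tanh t.
Proof. by rewrite /tanh opprK [X in _ / X]addrC -mulNr opprB. Qed.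

Lemma tanh0 : tanh (0 : R) = 0.
Proof. by rewrite /tanh oppr0 subrr mul0r. Qed.

Lemma tanhK : cancel tanh artanh.
Proof.
move=> t; rewrite /artanh /tanh.
set a := expR t; set b := expR (- t).
have ab : a * b = 1 by exact: eM.
have a0 : 0 < a by exact: expR_gt0.
have b0 : 0 < b by exact: expR_gt0.
have -> : (1 + (a - b) / (a + b)) / (1 - (a - b) / (a + b)) = a / b.
  by field; repeat (apply/andP; split); apply/eqP; lra.
have -> : a / b = expR (t + t).
  by rewrite expRD -/a /b expRN invrK.
by rewrite expRK; field.
Qed.

Lemma artanhK (s : R) : -1 < s < 1 -> tanh (artanh s) = s.
Proof.
move=> /andP[s1 s2]; rewrite /tanh; set u := artanh s.
have h : expR u * expR u = (1 + s) / (1 - s).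
  rewrite -expRD /u /artanh.
  rewrite (_ : ln _ / 2 + _ = ln ((1 + s) / (1 - s))); last by field.
  by rewrite lnK // posrE divr_gt0 //; lra.
have b : expR (- u) = (expR u)^-1 by rewrite expRN.
have u0 := expR_gt0 u.
rewrite b.
have -> : (expR u - (expR u)^-1) / (expR u + (expR u)^-1) =
  (expR u * expR u - 1) / (expR u * expR u + 1).
  by field; repeat (apply/andP; split); apply/eqP; nra.
by rewrite h; field; repeat (apply/andP; split); apply/eqP; lra.
Qed.

Lemma coshK (t : R) : arcosh (cosh t) = `|t|.
Proof.
have key : forall s : R, 0 <= s -> arcosh (cosh s) = s.
  move=> s s0; rewrite /arcosh /cosh.
  have -> : ((expR s + expR (- s)) / 2) ^+ 2 - 1 =
            ((expR s - expR (- s)) / 2) ^+ 2.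
    by have := eM s; rewrite !expr_div_n sqrrB sqrrD => ->; field.
  have le : expR (- s) <= expR s by rewrite ler_expR; lra.
  rewrite sqrtr_sqr ger0_norm; last by apply: divr_ge0; lra.
  by rewrite -mulrDl [X in ln X](_ : _ = expR s) ?expRK //; field.
have [t0|t0] := leP 0 t; first by rewrite key // ger0_norm.
rewrite ltr0_norm // -[RHS]key ?oppr_ge0 ?ltW //.
by rewrite /cosh opprK (addrC (expR t)).
Qed.

Lemma cosh_half (s t : R) : tanh (t / 2) ^+ 2 = s ->
  cosh t = (1 + s) / (1 - s).
Proof.
move=> <-; rewrite /cosh /tanh.
have {1}-> : t = t / 2 + t / 2 by field.
have -> : - t = - (t / 2) + - (t / 2) by field.
rewrite !expRD; move: (eM (t / 2)) (expR_gt0 (t / 2)) (expR_gt0 (- (t / 2))).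
set a := expR _; set b := expR _ => ab a0 b0.
have -> : (1 + ((a - b) / (a + b)) ^+ 2) / (1 - ((a - b) / (a + b)) ^+ 2)
        = (a * a + b * b) / (2 * (a * b)).
  field; repeat (apply/andP; split); apply/eqP; nra.
by rewrite ab mulr1.
Qed.

Lemma cosh_tanhB (a b : R) : cosh (2 * (a - b)) =
  1 + 2 * ((tanh a - tanh b) ^+ 2 / ((1 - tanh a ^+ 2) * (1 - tanh b ^+ 2))).
Proof.
rewrite /cosh /tanh.
have -> : - (2 * (a - b)) = (- a + - a) + (b + b) by ring.
have -> : 2 * (a - b) = (a + a) + (- b + - b) by ring.
rewrite !expRD; move: (eM a) (expR_gt0 a) (expR_gt0 (- a)).
move: (eM b) (expR_gt0 b) (expR_gt0 (- b)).
set p := expR a; set q := expR (- a); set r := expR b; set s := expR (- b).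
move=> rs r0 s0 pq p0 q0.
have qE : q = p^-1 by rewrite /q expRN.
have sE : s = r^-1 by rewrite /s expRN.
have p1 : p != 0 by rewrite gt_eqF.
have r1 : r != 0 by rewrite gt_eqF.
have pp : p ^+ 2 + 1 != 0 by rewrite gt_eqF // ltr_wpDl ?sqr_ge0.
have rr : r ^+ 2 + 1 != 0 by rewrite gt_eqF // ltr_wpDl ?sqr_ge0.
have TE (x : R) : x != 0 -> x ^+ 2 + 1 != 0 ->
    (x - x^-1) / (x + x^-1) = 1 - 2 / (x ^+ 2 + 1).
  by move=> x0 xx; field; rewrite xx x0.
rewrite qE sE !TE //.
have QE (x : R) : x ^+ 2 + 1 != 0 ->
    1 - (1 - 2 / (x ^+ 2 + 1)) ^+ 2 = (2 * x / (x ^+ 2 + 1)) ^+ 2.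
  by move=> xx; field.
rewrite !QE //; field.
by rewrite p1 r1 pp rr.
Qed.

End HyperbolicFunctions.

Section HyperbolicPlane.
Context {R : realType}.
Implicit Types u v w : R * R.

Definition dot u v : R := u.1 * v.1 + u.2 * v.2.

(* The Poincare disc model: the open unit disc of R^2 with the Riemannian
   metric 4 (dx1^2 + dx2^2) / (1 - |x|^2)^2.  The tangent space at every
   point is R^2. *)
Record hplane := HPlane {
  hcoord :> R * R;
  hcoordP : dot hcoord hcoord < 1 }.

HB.instance Definition _ := [isSub for hcoord].
HB.instance Definition _ := gen_eqMixin hplane.
HB.instance Definition _ := gen_choiceMixin hplane.

Lemma horigin_subproof : dot (0, 0) (0, 0) < 1.
Proof. by rewrite /dot /= !mul0r addr0. Qed.

Definition horigin : hplane := HPlane horigin_subproof.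

HB.instance Definition _ := isPointed.Build hplane horigin.

Definition conformal (x : R * R) : R := 2 / (1 - dot x x).

Definition riem (x : hplane) u v : R := conformal x ^+ 2 * dot u v.

Definition riem_norm (x : hplane) v : R := Num.sqrt (riem x v v).

Definition hdist (x y : hplane) : R :=
  arcosh (1 + 2 * dot (hcoord x - hcoord y) (hcoord x - hcoord y) /
                  ((1 - dot x x) * (1 - dot y y))).

(* Moebius addition, i.e. (x + w) / (1 + conj(x) w) in complex notation:
   w |-> mobius_add x w is the orientation-preserving isometry of the disc
   mapping 0 to x whose differential at 0 is a positive scalar. *)
Definition mobius_add (x w : R * R) : R * R :=
  (1 + 2 * dot x w + dot x x * dot w w)^-1 *:
    ((1 + 2 * dot x w + dot w w) *: x + (1 - dot x x) *: w).

(* At v = 0 the quotient is 0 / 0 = 0, so hexp_coord x 0 = x. *)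
Definition hexp_coord (x : hplane) v : R * R :=
  mobius_add x
    ((tanh (riem_norm x v / 2) / Num.sqrt (dot v v)) *: v).

Lemma dot_lt1 u v : dot u u < 1 -> dot v v < 1 ->
  0 < 1 + 2 * dot u v + dot u u * dot v v.
Proof.
rewrite /dot => hu hv.
have -> : 1 + 2 * (u.1 * v.1 + u.2 * v.2) +
    (u.1 * u.1 + u.2 * u.2) * (v.1 * v.1 + v.2 * v.2) =
  (1 + (u.1 * v.1 + u.2 * v.2)) ^+ 2 + (u.1 * v.2 - u.2 * v.1) ^+ 2 by ring.
have h : 0 < 1 + (u.1 * v.1 + u.2 * v.2).
  have := sqr_ge0 (u.1 + v.1); have := sqr_ge0 (u.2 + v.2).
  by rewrite !expr2; lra.
by rewrite ltr_pwDl ?sqr_ge0 // exprn_gt0.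
Qed.

Lemma dot_ge0 u : 0 <= dot u u.
Proof. by rewrite /dot -!expr2 addr_ge0 ?sqr_ge0. Qed.

Lemma dot_eq0 u : dot u u = 0 -> u = 0.
Proof.
case: u => a b; rewrite /dot /= -!expr2 => /eqP.
by rewrite paddr_eq0 ?sqr_ge0 // !sqrf_eq0 => /andP[/eqP -> /eqP ->].
Qed.

Lemma pairZE (a : R) u : a *: u = (a * u.1, a * u.2).
Proof. by []. Qed.

Lemma dotZ (a b : R) u v : dot (a *: u) (b *: v) = a * b * dot u v.
Proof. by rewrite !pairZE /dot /=; ring. Qed.

Lemma mobius_add_coord u v : mobius_add u v =
  (((1 + 2 * dot u v + dot v v) * u.1 + (1 - dot u u) * v.1) /
     (1 + 2 * dot u v + dot u u * dot v v),
   ((1 + 2 * dot u v + dot v v) * u.2 + (1 - dot u u) * v.2) /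
     (1 + 2 * dot u v + dot u u * dot v v)).
Proof.
by rewrite /mobius_add !pairZE /=; congr (_, _); rewrite mulrC.
Qed.

Lemma mobius_add_dot u v : dot u u < 1 -> dot v v < 1 ->
  1 - dot (mobius_add u v) (mobius_add u v) =
  (1 - dot u u) * (1 - dot v v) / (1 + 2 * dot u v + dot u u * dot v v).
Proof.
move=> hu hv; have h := dot_lt1 hu hv; rewrite mobius_add_coord.
move: h; case: u hu => a b hu; case: v hv => c d hv; rewrite /dot /= => h.
by field; rewrite gt_eqF.
Qed.

Lemma mobius_add_lt1 u v : dot u u < 1 -> dot v v < 1 ->
  dot (mobius_add u v) (mobius_add u v) < 1.
Proof.
move=> hu hv; have h := dot_lt1 hu hv.
by rewrite -subr_gt0 mobius_add_dot // divr_gt0 // mulr_gt0 // subr_gt0.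
Qed.

Lemma dotN u : dot (- u) (- u) = dot u u.
Proof. by rewrite /dot /=; ring. Qed.

Lemma mobius_addK u v : dot u u < 1 -> dot v v < 1 ->
  mobius_add (- u) (mobius_add u v) = v.
Proof.
move=> hu hv; have h := dot_lt1 hu hv.
set D := 1 + 2 * dot u v + dot u u * dot v v in h.
have D0 : D != 0 by rewrite gt_eqF.
have u0 : 1 - dot u u != 0 by rewrite gt_eqF // subr_gt0.
have -> : v = (v.1, v.2) by case: v {hv h D0 D}.
set z := mobius_add u _.
have hz : z = (((1 + 2 * dot u v + dot v v) * u.1 + (1 - dot u u) * v.1) / D,
               ((1 + 2 * dot u v + dot v v) * u.2 + (1 - dot u u) * v.2) / D).
  exact: mobius_add_coord.
have den : 1 + 2 * dot (- u) z + dot (- u) (- u) * dot z z =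
    (1 - dot u u) ^+ 2 / D.
  by rewrite hz /D; move: D0; rewrite /D /dot /= => D0; field.
have n1 : (1 + 2 * dot (- u) z + dot z z) * (- u).1 +
    (1 - dot (- u) (- u)) * z.1 = (1 - dot u u) ^+ 2 / D * v.1.
  by rewrite hz /D; move: D0; rewrite /D /dot /= => D0; field.
have n2 : (1 + 2 * dot (- u) z + dot z z) * (- u).2 +
    (1 - dot (- u) (- u)) * z.2 = (1 - dot u u) ^+ 2 / D * v.2.
  by rewrite hz /D; move: D0; rewrite /D /dot /= => D0; field.
rewrite mobius_add_coord den n1 n2.
have k0 : (1 - dot u u) ^+ 2 / D != 0 by rewrite mulf_neq0 ?invr_eq0 ?expf_neq0.
by congr (_, _); rewrite mulrAC divff // mul1r.
Qed.

Lemma mobius_addNK u v : dot u u < 1 -> dot v v < 1 ->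
  mobius_add u (mobius_add (- u) v) = v.
Proof.
by move=> hu hv; rewrite -{1}[u]opprK mobius_addK // dotN.
Qed.

Lemma hexp_subproof_vec (t : R) v :
  dot ((tanh t / Num.sqrt (dot v v)) *: v) ((tanh t / Num.sqrt (dot v v)) *: v)
    = if v == 0 then 0 else tanh t ^+ 2.
Proof.
rewrite dotZ; case: eqP => [->|/eqP v0].
  by rewrite /dot /= !mul0r addr0 mulr0.
have d0 : dot v v != 0 by apply: contra v0 => /eqP /dot_eq0 /eqP.
rewrite -[X in _ * X]sqr_sqrtr ?dot_ge0 //.
have s0 : Num.sqrt (dot v v) != 0.
  by rewrite sqrtr_eq0 -ltNge lt_neqAle eq_sym d0 dot_ge0.
by rewrite expr2; field.
Qed.

Lemma hexp_vec_lt1 (t : R) v :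
  dot ((tanh t / Num.sqrt (dot v v)) *: v)
      ((tanh t / Num.sqrt (dot v v)) *: v) < 1.
Proof.
by rewrite hexp_subproof_vec; case: eqP => _; rewrite ?tanh_sqr_lt1 ?ltr01.
Qed.

Lemma hexp_subproof (x : hplane) v :
  dot (hexp_coord x v) (hexp_coord x v) < 1.
Proof.
exact: mobius_add_lt1 (hcoordP x) (hexp_vec_lt1 _ v).
Qed.

Definition hexp (x : hplane) v : hplane := HPlane (hexp_subproof x v).

(* The inverse of hexp x, which is a bijection by hexp_hlog and hlog_hexp
   below. *)
Definition hlog (x y : hplane) : R * R := xget 0 [set v | hexp x v = y].

Definition hlog_formula (x y : hplane) : R * R :=
  let w := mobius_add (- hcoord x) y in
  (2 / conformal x * artanh (Num.sqrt (dot w w)) / Num.sqrt (dot w w)) *: w.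

Lemma conformal_gt0 (x : hplane) : 0 < conformal x.
Proof. by rewrite /conformal divr_gt0 // subr_gt0 hcoordP. Qed.

Lemma riem_normE (x : hplane) v :
  riem_norm x v = conformal x * Num.sqrt (dot v v).
Proof.
rewrite /riem_norm /riem sqrtrM ?sqr_ge0 // sqrtr_sqr ger0_norm //.
exact/ltW/conformal_gt0.
Qed.

Lemma hcoord_inj : injective (@hcoord).
Proof. exact: val_inj. Qed.

Lemma artanh0 : artanh (0 : R) = 0.
Proof. by rewrite /artanh addr0 subr0 divr1 ln1 mul0r. Qed.

Lemma artanh_ge0 (s : R) : 0 <= s < 1 -> 0 <= artanh s.
Proof.
move=> /andP[s0 s1]; rewrite /artanh divr_ge0 // ln_ge0 //.
by rewrite ler_pdivlMr; lra.
Qed.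

Lemma tanh_ge0 (t : R) : 0 <= t -> 0 <= tanh t.
Proof.
move=> t0; rewrite /tanh divr_ge0 ?subr_ge0 ?ler_expR; [lra| |].
  by lra.
by rewrite addr_ge0 ?expR_ge0.
Qed.

Lemma hexpK (x : hplane) v : hlog_formula x (hexp x v) = v.
Proof.
rewrite /hlog_formula /= /hexp_coord.
rewrite (mobius_addK (hcoordP x) (hexp_vec_lt1 _ v)).
rewrite hexp_subproof_vec; case: eqP => [->|/eqP v0]; first by rewrite !scaler0.
have d0 : dot v v != 0 by apply: contra v0 => /eqP /dot_eq0 /eqP.
have s0 : Num.sqrt (dot v v) != 0.
  by rewrite sqrtr_eq0 -ltNge lt_neqAle eq_sym d0 dot_ge0.
have c0 := conformal_gt0 x; have c1 : conformal x != 0 by rewrite gt_eqF.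
have r0 : 0 < riem_norm x v / 2.
  rewrite riem_normE divr_gt0 // mulr_gt0 // lt_neqAle eq_sym s0.
  exact: sqrtr_ge0.
rewrite sqrtr_sqr ger0_norm ?tanh_ge0 ?(ltW r0) // tanhK.
have t0 : tanh (riem_norm x v / 2) != 0.
  apply: contraTneq r0 => h.
  by rewrite -[riem_norm x v / 2]tanhK h -[in artanh _]tanh0 tanhK ltxx.
rewrite scalerA [X in X *: _](_ : _ = 1) ?scale1r // riem_normE.
move: t0; rewrite riem_normE; set t := tanh _ => t0.
by field; rewrite t0 s0 c1.
Qed.

Lemma hlog_formulaK (x y : hplane) : hexp x (hlog_formula x y) = y.
Proof.
have nx : dot (- hcoord x) (- hcoord x) < 1 by rewrite dotN hcoordP.
apply: hcoord_inj => /=; rewrite /hexp_coord /hlog_formula.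
rewrite -[RHS](mobius_addNK (hcoordP x) (hcoordP y)); congr mobius_add.
have := mobius_add_lt1 nx (hcoordP y); set w := mobius_add (- hcoord x) y => w1.
have [->|/eqP w0] := eqVneq w 0; first by rewrite !scaler0.
have d0 : dot w w != 0 by apply: contra_notN w0 => /eqP /dot_eq0.
set s := Num.sqrt (dot w w).
have s0 : s != 0 by rewrite sqrtr_eq0 -ltNge lt_neqAle eq_sym d0 dot_ge0.
have sge0 : 0 <= s by exact: sqrtr_ge0.
have s1 : s < 1.
  by rewrite -[ltRHS]sqrtr1 ltr_sqrt.
have ts : tanh (artanh s) = s by rewrite artanhK // s1 andbT; lra.
have a0 : artanh s != 0 by apply: contraNneq s0 => a0; rewrite -ts a0 tanh0.
have c0 := conformal_gt0 x; have c1 : conformal x != 0 by rewrite gt_eqF.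
set c := 2 / conformal x * artanh s / s.
have cge0 : 0 <= c.
  by rewrite /c divr_ge0 // mulr_ge0 ?artanh_ge0 ?sge0 // divr_ge0 // ltW.
have cn : c != 0.
  by rewrite /c mulf_neq0 ?invr_eq0 // mulf_neq0 // mulf_neq0 ?invr_eq0 ?pnatr_eq0.
rewrite scalerA -[RHS]scale1r; congr (_ *: _).
have cc : 0 <= c * c by exact: (mulr_ge0 cge0).
rewrite riem_normE dotZ (sqrtrM _ cc) -(expr2 c) sqrtr_sqr ger0_norm // -/s.
rewrite [conformal x * _ / 2](_ : _ = artanh s); last by rewrite /c; field; apply/andP.
by rewrite ts; field; apply/andP.
Qed.

Lemma hlogE (x y : hplane) : hlog x y = hlog_formula x y.
Proof.
rewrite /hlog; case: xgetP => [v _ <-|/(_ (hlog_formula x y))].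
  by rewrite hexpK.
by rewrite /= hlog_formulaK.
Qed.

Lemma hexp_hlog (x y : hplane) : hexp x (hlog x y) = y.
Proof. by rewrite hlogE hlog_formulaK. Qed.

Lemma hlog_hexp (x : hplane) v : hlog x (hexp x v) = v.
Proof. by rewrite hlogE hexpK. Qed.

Lemma mobius_add_dist u a b : dot u u < 1 -> dot a a < 1 -> dot b b < 1 ->
  let d x y := dot (x - y) (x - y) / ((1 - dot x x) * (1 - dot y y)) in
  d (mobius_add u a) (mobius_add u b) = d a b.
Proof.
move=> hu ha hb /=.
have D1 : 1 + 2 * dot u a + dot u u * dot a a != 0 by rewrite gt_eqF // dot_lt1.
have D2 : 1 + 2 * dot u b + dot u u * dot b b != 0 by rewrite gt_eqF // dot_lt1.
have -> : dot (mobius_add u a - mobius_add u b) (mobius_add u a - mobius_add u b)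
  = (1 - dot u u) ^+ 2 * dot (a - b) (a - b) /
    ((1 + 2 * dot u a + dot u u * dot a a) *
     (1 + 2 * dot u b + dot u u * dot b b)).
  rewrite !mobius_add_coord; move: D1 D2; rewrite /dot /= => D1 D2.
  by field; apply/andP.
rewrite !mobius_add_dot //.
have u0 : 1 - dot u u != 0 by rewrite gt_eqF // subr_gt0.
have a0 : 1 - dot a a != 0 by rewrite gt_eqF // subr_gt0.
have b0 : 1 - dot b b != 0 by rewrite gt_eqF // subr_gt0.
by field; rewrite D1 D2 u0 a0 b0.
Qed.

(* Hence t |-> hexp x (t *: v) is a geodesic of constant speed. *)
Lemma hexp_geodesic (x : hplane) v (s t : R) :
  hdist (hexp x (s *: v)) (hexp x (t *: v)) = `|s - t| * riem_norm x v.
Proof.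
have [->|/eqP v0] := eqVneq v 0.
  rewrite !scaler0 riem_normE {1}/dot /= !mul0r addr0 sqrtr0 !mulr0.
  rewrite /hdist subrr {1}/dot /= !mul0r addr0 mulr0 mul0r addr0.
  by rewrite /arcosh expr1n subrr sqrtr0 addr0 ln1.
have d0 : dot v v != 0 by apply: contra_notN v0 => /eqP /dot_eq0.
set n := Num.sqrt (dot v v).
have n0 : 0 < n by rewrite sqrtr_gt0 lt_neqAle eq_sym d0 dot_ge0.
set c := riem_norm x v.
have hE r : hexp_coord x (r *: v) =
    mobius_add x ((tanh (r * c / 2) / n) *: v).
  rewrite /hexp_coord; congr mobius_add.
  rewrite scalerA; congr (_ *: _).
  rewrite riem_normE dotZ sqrtrM -?expr2 ?sqr_ge0 // sqrtr_sqr -/n.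
  have -> : conformal x * (`|r| * n) = `|r| * c.
    by rewrite /c riem_normE -/n mulrCA.
  have nn : n != 0 by rewrite gt_eqF.
  have [r0|r0|->] := ltgtP r 0.
  - rewrite ltr0_norm // !mulNr tanhN.
    by field; rewrite nn lt_eqF.
  - by rewrite gtr0_norm //; field; rewrite nn gt_eqF.
  - by rewrite mulr0 !mul0r tanh0 mul0r.
have hv r : dot ((tanh r / n) *: v) ((tanh r / n) *: v) = tanh r ^+ 2.
  by rewrite hexp_subproof_vec; case: eqP v0.
rewrite /hdist /= !hE -mulrA mobius_add_dist ?hcoordP ?hv ?tanh_sqr_lt1 //.
rewrite -scalerBl -mulrBl.
have -> : dot (((tanh (s * c / 2) - tanh (t * c / 2)) / n) *: v)
   (((tanh (s * c / 2) - tanh (t * c / 2)) / n) *: v) =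
   (tanh (s * c / 2) - tanh (t * c / 2)) ^+ 2.
  rewrite dotZ -[X in _ * X]sqr_sqrtr ?dot_ge0 // -/n.
  by field; rewrite gt_eqF.
have -> : 1 + 2 * ((tanh (s * c / 2) - tanh (t * c / 2)) ^+ 2 /
    ((1 - tanh (s * c / 2) ^+ 2) * (1 - tanh (t * c / 2) ^+ 2))) =
    cosh ((s - t) * c).
  by rewrite -cosh_tanhB; congr cosh; field.
rewrite coshK normrM [`|c|]ger0_norm //; exact: sqrtr_ge0.
Qed.

Lemma hdist_hexp (x : hplane) v : hdist x (hexp x v) = riem_norm x v.
Proof.
have := hexp_geodesic x v 0 1; rewrite scale0r scale1r sub0r normrN1 mul1r.
suff -> : hexp x 0 = x by [].
apply: hcoord_inj; rewrite /= /hexp_coord scaler0 mobius_add_coord.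
case: (hcoord x) => a b; rewrite /dot /= !mulr0 !addr0 !mulr0 !addr0.
by rewrite !divr1 !mul1r.
Qed.

Lemma riem_norm_hlog (x y : hplane) : riem_norm x (hlog x y) = hdist x y.
Proof. by rewrite -{2}(hexp_hlog x y) hdist_hexp. Qed.

End HyperbolicPlane.

Arguments hplane R : clear implicits.

(* The Borel sigma-algebra of the disc: the trace of that of R^2. *)
HB.instance Definition _ (R : realType) := Measurable.copy (hplane R)
  (g_sigma_algebra_preimageType (@hcoord R)).

Section Increments.
Context {R : realType}.
Implicit Types x y : hplane R.

Definition hsphere (r : R) : set (hplane R) :=
  [set x | hdist horigin x = r].

Definition e_rad x : R * R :=
  (riem_norm x (hlog x horigin))^-1 *: hlog x horigin.

(* d_tot (X n w) (X n.+1 w) and d_rad (X n w) (X n.+1 w) are the total and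
   radial lengths of the n-th increment. *)
Definition d_tot x y : R := riem_norm x (hlog x y).

Definition d_rad x y : R :=
  if x == horigin then d_tot x y else - riem x (hlog x y) (e_rad x).

End Increments.

Section MarkovChains.
Context {R : realType}.

(* Y is a version of the conditional expectation of Z given the
   sub-sigma-algebra G. *)
Definition is_cond_expectation d (Omega : measurableType d)
    (P : probability Omega R) (G : set (set Omega)) (Z Y : Omega -> R) : Prop :=
  [/\ P.-integrable setT (EFin \o Z),
      P.-integrable setT (EFin \o Y),
      (forall B, measurable B -> G (Y @^-1` B)) &
      forall E, G E ->
        (\int[P]_(w in E) (Y w)%:E = \int[P]_(w in E) (Z w)%:E)%E].

Section Process.
Context d (Omega : measurableType d) (P : probability Omega R).
Implicit Type X : nat -> {RV P >-> hplane R}.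

Definition natural_filtration X (n : nat) : set (set Omega) :=
  <<s \bigcup_(k in [set k | (k <= n)%N]) g_sigma_algebra_preimage (X k) >>.

Definition markov_chain (K : R.-pker (hplane R) ~> (hplane R)) X : Prop :=
  forall n A, measurable A ->
    is_cond_expectation P (natural_filtration X n)
      (fun w => \1_A (X n.+1 w)) (fun w => fine (K (X n w) A)).

Definition started_at (x : hplane R) X : Prop := {ae P, forall w, X 0 w = x}.

(* All tangent spaces of the disc model are R^2 and |v| <= riem_norm x v / 2,
   so the conditional expectation of a random tangent vector at X_n can be
   taken componentwise. *)
Definition zero_drift X : Prop :=
  forall n,
    is_cond_expectation P (natural_filtration X n)
      (fun w => (hlog (X n w) (X n.+1 w)).1) (cst 0) /\
    is_cond_expectation P (natural_filtration X n)
      (fun w => (hlog (X n w) (X n.+1 w)).2) (cst 0).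

Definition transient X : Prop :=
  {ae P, forall w, hdist horigin (X n w) @[n --> \oo] --> +oo}.

Definition non_confined X : Prop :=
  {ae P, forall w, limn_esup (fun n => (hdist (X n w) horigin)%:E) = +oo%E}.

End Process.

(* E_x[f(d_tot, d_rad)] for the chain with transition kernel K. *)
Definition E_jump (K : R.-pker (hplane R) ~> (hplane R)) (x : hplane R)
    (f : R -> R -> R) : \bar R :=
  (\int[K x]_y (f (d_tot x y) (d_rad x y))%:E)%E.

Definition bounded_jump_moments
    (K : R.-pker (hplane R) ~> (hplane R)) : Prop :=
  exists (p B : R), 2 < p /\
    forall x : hplane R, (\int[K x]_y ((hdist x y) `^ p)%:E <= B%:E)%E.

End MarkovChains.

(* Main.v *)
(* From x the walk jumps, with probability 1/2 each, to exp_x(v) and exp_x(-v),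
   where v has length 1 - |x|^2 (in disc coordinates) and is orthogonal to the
   radius, in an arbitrary direction at O.  The increments have zero drift and
   d_rad = 0, so d_tot^2 - d_rad^2 = (1 - |x|^2)^2 = O(e^{-2r}) on S(r).  In
   negative curvature a tangential jump increases the distance to O by an amount
   which depends only on that distance, so transience is deterministic:
   (1 - |X_n|^2)^-2 grows at least linearly in n.

   The coins are the binary digits of a uniform point of [0, 1[.  Flipping the
   n-th digit preserves Lebesgue measure and the events determined by the first
   n digits (counted from 0), hence every event of the past of X_n, while it
   exchanges the two possible values of X_{n+1}; this gives all the conditional
   expectations. *)
Require Import Defs.
From HB Require Import structures.
From mathcomp Require Import all_boot all_order all_algebra.
From mathcomp Require Import all_classical all_reals all_analysis.
From mathcomp Require Import measurable_realfun.
From mathcomp Require Import zify ring lra.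

Set Implicit Arguments.
Unset Strict Implicit.
Unset Printing Implicit Defensive.

Import Order.TTheory GRing.Theory Num.Theory.
Import numFieldNormedType.Exports.

Local Open Scope classical_set_scope.
Local Open Scope ring_scope.

(** * Binary digits as fair coins *)

Lemma preimage_measurable d d' (T : measurableType d) (T' : measurableType d')
    (f : T -> T') (A : set T') :
  measurable_fun setT f -> measurable A -> measurable (f @^-1` A).
Proof. by move=> mf mA; rewrite -[X in measurable X]setTI; exact: mf. Qed.

Section BinaryDigits.
Context {R : realType}.
Implicit Types (w : R) (n k : nat).

Definition dyadic_index n w : int := Num.floor (2 ^+ n * w).

Lemma dyadic_index_itv n w :
  (dyadic_index n w)%:~R <= 2 ^+ n * w < (dyadic_index n w)%:~R + 1.
Proof. by have := floor_itv (2 ^+ n * w); rewrite intrD. Qed.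

Lemma dyadic_indexP n w (m : int) :
  m%:~R <= 2 ^+ n * w < m%:~R + 1 -> dyadic_index n w = m.
Proof. by move=> h; apply: floor_def; rewrite intrD. Qed.

Definition binary_digit n w : bool :=
  dyadic_index n.+1 w == 2 * dyadic_index n w + 1.

(** With [b] the index at level [n], the floor inequalities put the next index strictly between
    [2 * b - 1] and [2 * b + 2], which leaves only [2 * b] and [2 * b + 1]. *)
Lemma dyadic_indexS n w :
  dyadic_index n.+1 w = 2 * dyadic_index n w + (binary_digit n w)%:Z.
Proof.
rewrite /binary_digit; case: eqP => // h.
have h1 := dyadic_index_itv n w; have h2 := dyadic_index_itv n.+1 w.
move: h h1 h2; rewrite exprS -mulrA.
set a := dyadic_index n.+1 w; set b := dyadic_index n w; set y := 2 ^+ n * w.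
move=> h h1 h2.
have a1 : (2 * b < a + 1)%R.
  by rewrite -(ltr_int R) intrD intrM; lra.
have a2 : (a < 2 * b + 2)%R.
  by rewrite -(ltr_int R) intrD intrM; lra.
by lia.
Qed.

(** Each index is the quotient by 2 of the next one, so a finer index determines all coarser
    ones. *)
Lemma dyadic_index_mono n k w v : (k <= n)%N ->
  dyadic_index n w = dyadic_index n v -> dyadic_index k w = dyadic_index k v.
Proof.
move=> /subnKC <-; elim: (n - k)%N => [|m IH]; first by rewrite addn0.
rewrite addnS !dyadic_indexS => h; apply: IH; move: h.
by case: binary_digit; case: binary_digit => /=; lia.
Qed.

Definition flip_digit n w : R :=
  if binary_digit n w then w - (2 ^+ n.+1)^-1 else w + (2 ^+ n.+1)^-1.

(** The shift by [(2 ^+ n.+1)^-1] moves [2 ^+ n.+1 * w] by exactly one, hence also its floor. *)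
Lemma dyadic_index_flipS n w : dyadic_index n.+1 (flip_digit n w) =
  2 * dyadic_index n w + (~~ binary_digit n w)%:Z.
Proof.
have h := dyadic_indexS n w; have i := dyadic_index_itv n.+1 w.
have e : (2 ^+ n.+1 : R) != 0 by rewrite expf_neq0.
apply: dyadic_indexP; rewrite /flip_digit; move: i; rewrite h.
by case: binary_digit; rewrite /= ?addr0 ?mulrDr ?mulrN mulfV// ?intrD; lra.
Qed.

Lemma dyadic_index_flip n w : dyadic_index n (flip_digit n w) = dyadic_index n w.
Proof.
have := dyadic_indexS n (flip_digit n w); rewrite dyadic_index_flipS.
by case: binary_digit; case: binary_digit => /=; lia.
Qed.

Lemma binary_digit_flip n w : binary_digit n (flip_digit n w) = ~~ binary_digit n w.
Proof.
have := dyadic_indexS n (flip_digit n w).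
rewrite dyadic_index_flipS dyadic_index_flip.
by case: binary_digit; case: binary_digit => /=; lia.
Qed.

Lemma binary_digit_flip_lt n k w : (k < n)%N ->
  binary_digit k (flip_digit n w) = binary_digit k w.
Proof.
move=> kn; have e := dyadic_index_flip n w.
by rewrite /binary_digit (dyadic_index_mono kn e) (dyadic_index_mono (ltnW kn) e).
Qed.

Lemma measurable_dyadic_index n :
  measurable_fun [set: R] (fun w => (dyadic_index n w)%:~R : R).
Proof.
apply: nondecreasing_measurable => // x y xy.
by rewrite ler_int; apply: le_floor; rewrite ler_pM2l // exprn_gt0.
Qed.

Lemma measurable_binary_digit n : measurable_fun [set: R] (binary_digit n).
Proof.
rewrite (_ : binary_digit n = fun w =>
  (dyadic_index n.+1 w)%:~R == 2 * (dyadic_index n w)%:~R + 1 :> R); last first.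
  apply/funext => w; rewrite /binary_digit -(eqr_int R) intrD intrM //.
apply: measurable_fun_eqr; first exact: measurable_dyadic_index.
apply: measurable_funD; last exact: measurable_cst.
by apply: measurable_funM; [exact: measurable_cst|exact: measurable_dyadic_index].
Qed.

Lemma measurable_flip_digit n : measurable_fun [set: R] (flip_digit n).
Proof.
apply: measurable_fun_ifT; first exact: measurable_binary_digit.
  by apply: measurable_funB; [exact: measurable_id|exact: measurable_cst].
by apply: measurable_funD; [exact: measurable_id|exact: measurable_cst].
Qed.

End BinaryDigits.

(** * Invariance of Lebesgue measure under flipping a digit *)

Section CoinFlips.
Context {R : realType}.
Local Notation mu := (@lebesgue_measure R).

(** Lebesgue measure is determined by its values on half-open intervals, and translation preserves
    their length. *)
Lemma lebesgue_measure_translation (c : R) (A : set R) : measurable A ->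
  pushforward mu ((fun w => w + c) : _ -> measurableTypeR R) A = mu A.
Proof.
move=> mA.
have mc : measurable_fun [set: R] ((fun w => w + c) : R -> measurableTypeR R).
  by apply: measurable_funD; [exact: measurable_id|exact: measurable_cst].
apply/esym/lebesgue_measure_unique => //= _ [[a b]] _ <-.
rewrite /pushforward (_ : _ @^-1` _ = `]a - c, b - c]%classic); last first.
  by apply/seteqP; split=> x /=; rewrite !in_itv /= ltrBlDr lerBrDr.
rewrite !lebesgue_measure_itv /= !lte_fin ltrD2r.
by case: ifP => // _; rewrite -!EFinB; congr EFin; ring.
Qed.

(** The flip is a translation by [c] onto the points with digit 1 and by [- c] onto those with digit
    0, so the preimage of [A] is a disjoint union of translates of [A] meet [D] and of [A] minus
    [D]. *)
Lemma lebesgue_measure_flip_digit n (A : set R) : measurable A ->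
  mu (flip_digit n @^-1` A) = mu A.
Proof.
move=> mA; set D := @binary_digit R n @^-1` [set true].
have mD : measurable D.
  by apply: preimage_measurable => //; exact: measurable_binary_digit.
set c : R := (2 ^+ n.+1)^-1.
have mT (e : R) B : measurable B -> measurable ((fun w => w + e) @^-1` B).
  move=> mB; apply: preimage_measurable mB.
  by apply: measurable_funD; [exact: measurable_id|exact: measurable_cst].
have flipE : flip_digit n @^-1` A =
    ((fun w => w + c) @^-1` (A `&` D)) `|` ((fun w => w + - c) @^-1` (A `\` D)).
  have fE (w : R) : flip_digit n w = if binary_digit n w then w + - c else w + c.
    by [].
  apply/seteqP; split=> [w Aw|w [[Aw Dw]|[Aw Dw]]].
  - rewrite /D /=; have := binary_digit_flip n w.
    move: Aw; rewrite /preimage /= fE.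
    by case: binary_digit => Aw dw; [right|left]; rewrite /= dw.
  (* As [w] is the flip of [w + c], its digit is the opposite one, and its own flip leads back to
     [w + c]. *)
  - have wE : flip_digit n (w + c) = w by rewrite fE Dw addrK.
    by rewrite /preimage /= fE -{1}wE binary_digit_flip Dw.
  - have /negbTE Dn : ~~ binary_digit n (w - c) by apply/negP.
    have wE : flip_digit n (w - c) = w by rewrite fE Dn subrK.
    by rewrite /preimage /= fE -{1}wE binary_digit_flip Dn.
rewrite flipE measureU; first last.
(* A common point [w] would be the flip both of [w + c], with digit 1, and of [w - c], with digit
   0. *)
- rewrite -subset0 => w [[_ Dp] [_ Dm]] /=; rewrite /D /= in Dp Dm.
  have wE : flip_digit n (w + c) = w by rewrite /flip_digit Dp addrK.
  have /negbTE Dn : ~~ binary_digit n (w - c) by apply/negP.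
  have wE' : flip_digit n (w - c) = w by rewrite /flip_digit Dn subrK.
  have := binary_digit_flip n (w + c); rewrite wE Dp -{1}wE'.
  by rewrite binary_digit_flip Dn.
- by apply: mT; exact: measurableD.
- by apply: mT; exact: measurableI.
transitivity (mu (A `&` D) + mu (A `\` D))%E.
  congr (_ + _)%E; apply: lebesgue_measure_translation.
    exact: measurableI.
  exact: measurableD.
by rewrite addeC -measureDI.
Qed.

Definition unit_itv_prob := mrestr mu (measurable_itv `[(0 : R), 1[).

HB.instance Definition _ := Measure.on unit_itv_prob.

Lemma unit_itv_prob_setT : unit_itv_prob setT = 1%E.
Proof.
by rewrite /unit_itv_prob /mrestr setTI lebesgue_measure_itv /= lte01 oppr0 adde0.
Qed.

HB.instance Definition _ :=
  Measure_isProbability.Build _ _ _ unit_itv_prob unit_itv_prob_setT.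

Lemma unit_itv_prob_flip_digit n (A : set R) : measurable A ->
  unit_itv_prob (flip_digit n @^-1` A) = unit_itv_prob A.
Proof.
move=> mA; rewrite /unit_itv_prob /mrestr -[RHS](lebesgue_measure_flip_digit n).
  congr (mu _); rewrite preimage_setI; congr (_ `&` _).
  (* The unit interval is the set where the index at level 0 vanishes, and every flip preserves that
     index. *)
  have fl (w : R) : dyadic_index 0 (flip_digit n w) = dyadic_index 0 w.
    exact: dyadic_index_mono (leq0n n) (dyadic_index_flip n w).
  have itvE (w : R) : (w \in `[0, 1[) = (dyadic_index 0 w == 0).
    by rewrite in_itv /= /dyadic_index expr0 mul1r floor_eq add0r.
  by apply/seteqP; split=> w /=; rewrite !itvE fl.
by apply: measurableI => //; exact: measurable_itv.
Qed.

End CoinFlips.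

(** The maps [flip n] carry the fairness and independence of the coins: [flip n] preserves [P] and
    the earlier coins and reverses the coin [n]. *)
Lemma fair_coin_flips (R : realType) :
  exists (d : measure_display) (Omega : measurableType d)
         (P : probability Omega R) (xi : nat -> Omega -> bool)
         (flip : nat -> Omega -> Omega),
    [/\ forall n, measurable_fun setT (xi n),
        forall n, measurable_fun setT (flip n),
        forall n A, measurable A -> P (flip n @^-1` A) = P A,
        forall n k w, (k < n)%N -> xi k (flip n w) = xi k w &
        forall n w, xi n (flip n w) = ~~ xi n w].
Proof.
exists _, (measurableTypeR R), unit_itv_prob, binary_digit, flip_digit; split.
- exact: measurable_binary_digit.
- exact: measurable_flip_digit.
- exact: unit_itv_prob_flip_digit.
- by move=> n k w; exact: binary_digit_flip_lt.
- exact: binary_digit_flip.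
Qed.

(** * Two-point kernels and conditional expectations *)

Section CoinKernel.
Context d (T : measurableType d) (R : realType) (f : bool -> T -> T).
Hypothesis mf : forall b, measurable_fun setT (f b).

(* The proof argument is a phantom that keys the kernel instances below. *)
Definition coin_kernel (_ : forall b, measurable_fun setT (f b)) (x : T) :
    {measure set T -> \bar R} :=
  mscale (2^-1)%:nng (measure_add (dirac (f true x)) (dirac (f false x))).

Local Notation K := (coin_kernel mf).

Lemma coin_kernelE x (A : set T) :
  K x A = (2^-1 * (\1_A (f true x) + \1_A (f false x)))%:E.
Proof. by rewrite -[LHS]/(_ * measure_add _ _ A)%E measure_addE. Qed.

Let measurable_coin_kernel (U : set T) : measurable U ->
  measurable_fun setT (K ^~ U).
Proof.
move=> mU; under eq_fun do rewrite coin_kernelE.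
apply/measurable_EFinP/measurable_funM; first exact: measurable_cst.
apply: measurable_funD.
  by apply: (measurableT_comp (f := \1_U : T -> R)) (mf true); exact: measurable_indic.
by apply: (measurableT_comp (f := \1_U : T -> R)) (mf false); exact: measurable_indic.
Qed.

HB.instance Definition _ := isKernel.Build _ _ _ _ _ K measurable_coin_kernel.

Let coin_kernel_setT x : K x setT = 1%E.
Proof. by rewrite coin_kernelE !indicT /=; congr EFin; lra. Qed.

HB.instance Definition _ :=
  Kernel_isProbability.Build _ _ _ _ _ K coin_kernel_setT.

(** The nonnegative case is a sum of two Dirac integrals. The general case subtracts the integrals
    of the positive and negative parts, both finite. *)
Lemma integral_coin_kernel x (h : T -> R) : measurable_fun setT h ->
  (\int[K x]_y (h y)%:E = (2^-1 * (h (f true x) + h (f false x)))%:E)%E.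
Proof.
move=> mh.
have ge0E (k : T -> R) : measurable_fun setT k -> (forall y, 0 <= k y) ->
    (\int[K x]_y (k y)%:E = (2^-1 * (k (f true x) + k (f false x)))%:E)%E.
  move=> mk k0; have mEk : measurable_fun setT (EFin \o k) by exact/measurable_EFinP.
  rewrite /coin_kernel ge0_integral_mscale //; last by move=> y _; rewrite lee_fin.
  rewrite ge0_integral_measure_add //; last by move=> y _; rewrite lee_fin.
  by rewrite !integral_dirac // !diracT !mul1e -EFinD -EFinM.
have hE y : h^\+ y - h^\- y = h y by rewrite -[in RHS](funrposBneg h).
rewrite integralE funerpos funerneg !ge0E.
- by rewrite -EFinB -(hE (f true x)) -(hE (f false x)); congr EFin; ring.
- exact: measurable_funrneg.
- by move=> y; exact: funrneg_ge0.
- exact: measurable_funrpos.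
- by move=> y; exact: funrpos_ge0.
Qed.

End CoinKernel.

(** * Conditional expectations from a measure-preserving symmetry *)

Section FlipConditionalExpectation.
Context d (Omega : measurableType d) (R : realType) (P : probability Omega R).

Lemma bounded_integrable (Z : Omega -> R) (M : R) : measurable_fun setT Z ->
  (forall w, `|Z w| <= M) -> P.-integrable setT (EFin \o Z).
Proof.
move=> mZ ZM; apply: measurable_bounded_integrable => //.
  by rewrite (le_lt_trans (probability_le1 P measurableT)) ?ltry.
exists M; split; first exact: num_real.
by move=> N MN w _ /=; exact: le_trans (ZM w) (ltW MN).
Qed.

(** Since [s] preserves [P] and each event [E] of [G], the functions [Z] and [Z \o s] have the same
    integral over [E], and [Y] is their average. *)
Lemma flip_cond_expectation (G : set (set Omega)) (s : Omega -> Omega)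
    (Z Y : Omega -> R) (M : R) :
  measurable_fun setT s ->
  (forall A, measurable A -> P (s @^-1` A) = P A) ->
  (forall E, G E -> measurable E /\ s @^-1` E = E) ->
  measurable_fun setT Z -> (forall w, `|Z w| <= M) ->
  (forall w, Z w + Z (s w) = 2 * Y w) ->
  (forall B, measurable B -> G (Y @^-1` B)) ->
  is_cond_expectation P G Z Y.
Proof.
move=> ms Ps Gs mZ ZM ZY GY.
have iZ := bounded_integrable mZ ZM.
have mZs : measurable_fun setT (Z \o s) by exact: measurableT_comp mZ ms.
have iZs : P.-integrable setT (EFin \o (Z \o s)).
  by apply: (bounded_integrable mZs) => w; exact: ZM.
have mY : measurable_fun setT Y.
  by move=> _ B mB; rewrite setTI; have [] := Gs _ (GY B mB).
have YE w : Y w = 2^-1 * (Z w + Z (s w)) by rewrite ZY; field.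
have iY : P.-integrable setT (EFin \o Y).
  apply: (@bounded_integrable Y M) => // w.
  have := ZM w; have := ZM (s w).
  by rewrite YE !ler_norml; lra.
split=> // E /Gs [mE sE].
have EsE : (\int[P]_(w in E) (Z (s w))%:E = \int[P]_(w in E) (Z w)%:E)%E.
  rewrite -[in LHS]sE -(@integral_pushforward _ _ _ _ _ s ms P E (EFin \o Z)) //.
  - by apply: eq_measure_integral => A mA _; exact: Ps.
  - exact/measurable_EFinP.
  - by rewrite sE; exact: integrableS iZs.
have iZE : P.-integrable E (EFin \o Z) by exact: integrableS iZ.
have iZsE : P.-integrable E (EFin \o (Z \o s)) by exact: integrableS iZs.
under eq_integral do rewrite YE EFinM EFinD.
rewrite integralZl //; last exact: integrableD.
rewrite integralD // EsE.
have /fineK <- := integrable_fin_num mE iZE.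
by rewrite -EFinD -EFinM; congr EFin; field.
Qed.

End FlipConditionalExpectation.

(** * Walks driven by fair coins *)

Section CoinWalk.
Context {R : realType} (f : bool -> hplane R -> hplane R).
Hypothesis mf : forall b, measurable_fun setT (f b).

Section Walk.
Context d (Omega : measurableType d).
Variables (xi : nat -> Omega -> bool) (x0 : hplane R).

(** The coin [m] drives the step from time [m] to [m.+1], so the position at time [n] depends only
    on the coins below [n]. *)
Fixpoint coin_walk (n : nat) (w : Omega) : hplane R :=
  if n is m.+1 then f (xi m w) (coin_walk m w) else x0.

Hypothesis mxi : forall n, measurable_fun setT (xi n).

Lemma measurable_coin_choice d' (T : measurableType d')
    (h : bool -> hplane R -> T) (X : Omega -> hplane R) n :
  (forall b, measurable_fun setT (h b)) -> measurable_fun setT X ->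
  measurable_fun setT (fun w => h (xi n w) (X w)).
Proof.
move=> mh mX.
rewrite (_ : (fun w => _) =
    fun w => if xi n w then h true (X w) else h false (X w)); last first.
  by apply/funext => w; case: (xi n w).
by apply: measurable_fun_ifT => //; exact: measurableT_comp (mh _) mX.
Qed.

Lemma measurable_coin_walk n : measurable_fun setT (coin_walk n).
Proof.
elim: n => [|n IH] /=; first exact: measurable_cst.
exact: measurable_coin_choice.
Qed.

End Walk.

(** The flip of coin [n] fixes the walk up to time [n] and exchanges [h true] with [h false]. A
    general [h] serves both the Markov property and the drift. *)
Lemma exists_coin_walk (x0 : hplane R) :
  exists (d : measure_display) (Omega : measurableType d)
         (P : probability Omega R) (xi : nat -> Omega -> bool)
         (X : nat -> {RV P >-> hplane R}),
    [/\ forall w, X 0 w = x0,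
        forall n w, X n.+1 w = f (xi n w) (X n w) &
        forall n (h : bool -> hplane R -> R) (M : R),
          (forall b, measurable_fun setT (h b)) ->
          (forall b x, `|h b x| <= M) ->
          is_cond_expectation P (natural_filtration X n)
            (fun w => h (xi n w) (X n w))
            (fun w => 2^-1 * (h true (X n w) + h false (X n w)))].
Proof.
have := fair_coin_flips R.
move=> [d] [T] [P] [xi] [s] [mxi ms Ps xi_lt xi_eq].
have mX n := measurable_coin_walk x0 mxi n.
pose X n : {RV P >-> hplane R} :=
  MeasurableFun.Pack (MeasurableFun.Class (isMeasurableFun.Build _ _ _ _ _ (mX n))).
exists d, T, P, xi, X; split=> // n h M mh hM.
have Xs k w : (k <= n)%N -> X k (s n w) = X k w.
  elim: k => // k IH kn; rewrite /X /= xi_lt //; congr f.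
  exact: IH (ltnW kn).
apply: (flip_cond_expectation (s := s n) (M := M)) => //.
- exact: Ps.
- move=> E GE.
  (* The measurable sets invariant under the flip form a sigma-algebra, so only the generating
     events of the past need checking. *)
  apply: (@smallest_sub _ _ _ [set A | measurable A /\ s n @^-1` A = A] _ _ _ GE).
    split=> [|A [mA sA]|F mF].
    + by split; rewrite ?preimage_set0.
    + by split; [apply: measurableD|rewrite setTD -preimage_setC sA].
    + split; first by apply: bigcup_measurable => k _; have [] := mF k.
      by rewrite preimage_bigcup; apply: eq_bigcupr => k _; have [] := mF k.
  move=> A [k /= kn [B mB <-]]; rewrite setTI; split.
    exact: preimage_measurable (mX k) mB.
  by apply/seteqP; split=> w; move: (Xs k w kn); rewrite /preimage /= => ->.
- exact: (measurable_coin_choice mxi n mh (mX n)).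
- by move=> w; rewrite Xs // xi_eq; case: (xi n w) => /=; field.
- move=> B mB; apply: sub_gen_smallest; exists n => //=.
  exists ((fun x => 2^-1 * (h true x + h false x)) @^-1` B).
    apply: preimage_measurable mB.
    by apply: measurable_funM; [exact: measurable_cst|exact: measurable_funD].
  by rewrite setTI.
Qed.

End CoinWalk.

(** * Measurability in the disc model *)

Section Measurability.
Context {R : realType} d (T : measurableType d).
Implicit Types (f g : T -> R * R) (a : T -> R).

(** The inverse is [a] times a real power of [a ^+ 2]; the factor [a] restores the sign and yields
    the default value 0 at zeros of [a]. *)
Lemma measurable_funV a : measurable_fun setT a ->
  measurable_fun setT (fun x => (a x)^-1).
Proof.
move=> ma; have VE x : (a x)^-1 = a x * (a x ^+ 2) `^ (-1).
  rewrite powR_inv1 ?sqr_ge0 //.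
  by have [->|a0] := eqVneq (a x) 0; [rewrite invr0 mul0r|field].
under eq_fun do rewrite VE; apply: measurable_funM => //.
apply: (measurableT_comp (f := fun y : R => y `^ (-1))); first exact: measurable_powR.
exact: measurable_funX.
Qed.

Lemma measurable_fun_sqrt a : measurable_fun setT a ->
  measurable_fun setT (fun x => Num.sqrt (a x)).
Proof.
move=> ma; apply: (measurableT_comp (f := @Num.sqrt R)) ma.
by apply: continuous_measurable_fun; exact: sqrt_continuous.
Qed.

Lemma measurable_fun_ln a : measurable_fun setT a ->
  measurable_fun setT (fun x => ln (a x)).
Proof. by apply: (measurableT_comp (f := @ln R)); exact: measurable_ln. Qed.

Lemma measurable_fun_expR a : measurable_fun setT a ->
  measurable_fun setT (fun x => expR (a x)).
Proof. by apply: (measurableT_comp (f := @expR R)); exact: measurable_expR. Qed.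

Lemma measurable_fun1 f : measurable_fun setT f ->
  measurable_fun setT (fun x => (f x).1).
Proof. by apply: (measurableT_comp (f := @fst R R)); exact: measurable_fst. Qed.

Lemma measurable_fun2 f : measurable_fun setT f ->
  measurable_fun setT (fun x => (f x).2).
Proof. by apply: (measurableT_comp (f := @snd R R)); exact: measurable_snd. Qed.

Lemma measurable_dot f g : measurable_fun setT f -> measurable_fun setT g ->
  measurable_fun setT (fun x => dot (f x) (g x)).
Proof.
move=> mF mG; apply: measurable_funD; apply: measurable_funM;
  by [exact: measurable_fun1|exact: measurable_fun2].
Qed.

Lemma measurable_pairZ a f : measurable_fun setT a -> measurable_fun setT f ->
  measurable_fun setT (fun x => a x *: f x).
Proof.
move=> ma mF; apply: (@measurable_fun_pair _ _ _ _ _ _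
  (fun x => a x * (f x).1) (fun x => a x * (f x).2)); apply: measurable_funM => //.
  exact: measurable_fun1.
exact: measurable_fun2.
Qed.

Lemma measurable_pairD f g : measurable_fun setT f -> measurable_fun setT g ->
  measurable_fun setT (fun x => f x + g x).
Proof.
move=> mF mG; apply: (@measurable_fun_pair _ _ _ _ _ _
  (fun x => (f x).1 + (g x).1) (fun x => (f x).2 + (g x).2));
  apply: measurable_funD; by [exact: measurable_fun1|exact: measurable_fun2].
Qed.

Lemma measurable_mobius_add f g : measurable_fun setT f -> measurable_fun setT g ->
  measurable_fun setT (fun x => mobius_add (f x) (g x)).
Proof.
move=> mF mG; apply: measurable_pairZ.
  by apply: measurable_funV; do ![exact: measurable_cst|exact: measurable_dot|
    apply: measurable_funD|apply: measurable_funM].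
by apply: measurable_pairD; apply: measurable_pairZ => //;
  do ![exact: measurable_cst|exact: measurable_dot|apply: measurable_funB|
    apply: measurable_funD|apply: measurable_funM].
Qed.

Lemma measurable_fun_tanh a : measurable_fun setT a ->
  measurable_fun setT (fun x => tanh (a x)).
Proof.
move=> ma; have mN : measurable_fun setT (fun x => expR (- a x)).
  by apply: measurable_fun_expR; exact: measurable_funN.
apply: measurable_funM; first by apply: measurable_funB => //; exact: measurable_fun_expR.
apply: measurable_funV.
by apply: measurable_funD => //; exact: measurable_fun_expR.
Qed.

Lemma measurable_fun_artanh a : measurable_fun setT a ->
  measurable_fun setT (fun x => artanh (a x)).
Proof.
move=> ma; apply: measurable_funM; last exact: measurable_cst.
apply: measurable_fun_ln; apply: measurable_funM; first exact: measurable_funD.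
by apply: measurable_funV; exact: measurable_funB.
Qed.

Lemma measurable_hplane_coord (X : T -> hplane R) :
  measurable_fun setT (fun x => hcoord (X x)) -> measurable_fun setT X.
Proof.
move=> mX _ _ [B mB <-]; rewrite !setTI.
by have := mX measurableT _ mB; rewrite setTI.
Qed.

End Measurability.

Section MeasurableGeometry.
Context {R : realType}.

Lemma measurable_hcoord : measurable_fun setT (@hcoord R).
Proof. by move=> _ B mB; exists B. Qed.

Lemma measurable_hexp (v : hplane R -> R * R) : measurable_fun setT v ->
  measurable_fun setT (fun x => hexp x (v x)).
Proof.
move=> mv; apply: measurable_hplane_coord.
have mh := measurable_hcoord.
apply: measurable_mobius_add => //; apply: measurable_pairZ => //.
apply: measurable_funM; last first.
  by apply: measurable_funV; apply: measurable_fun_sqrt; exact: measurable_dot.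
apply: measurable_fun_tanh; apply: measurable_funM; last exact: measurable_cst.
apply: measurable_fun_sqrt; apply: measurable_funM; last exact: measurable_dot.
apply: measurable_funX; apply: measurable_funM; first exact: measurable_cst.
apply: measurable_funV; apply: measurable_funB; first exact: measurable_cst.
exact: measurable_dot.
Qed.

Lemma measurable_hlog (x : hplane R) : measurable_fun setT (hlog x).
Proof.
(* [hlog] is defined by choice; its closed formula is what exhibits measurability. *)
rewrite (_ : hlog x = hlog_formula x); last by apply/funext => y; exact: hlogE.
have mh := measurable_hcoord.
have mm : measurable_fun setT (fun y : hplane R => mobius_add (- hcoord x) y).
  by apply: measurable_mobius_add => //; exact: measurable_cst.
have ms : measurable_fun setT (fun y : hplane R => Num.sqrt
    (dot (mobius_add (- hcoord x) y) (mobius_add (- hcoord x) y))).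
  by apply: measurable_fun_sqrt; exact: measurable_dot.
apply: measurable_pairZ => //; apply: measurable_funM; last exact: measurable_funV.
apply: measurable_funM; first exact: measurable_cst.
exact: measurable_fun_artanh.
Qed.

Lemma measurable_d_tot (x : hplane R) : measurable_fun setT (d_tot x).
Proof.
have ml := measurable_hlog x.
apply: measurable_fun_sqrt; apply: measurable_funM; first exact: measurable_cst.
exact: measurable_dot.
Qed.

Lemma measurable_d_rad (x : hplane R) : measurable_fun setT (d_rad x).
Proof.
have ml := measurable_hlog x; rewrite /d_rad; case: (x == horigin).
  exact: measurable_d_tot.
apply: measurable_funN; apply: measurable_funM; first exact: measurable_cst.
by apply: measurable_dot => //; exact: measurable_cst.
Qed.

End MeasurableGeometry.

(** * The tangential step *)

Section TangentialStep.
Context {R : realType}.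
Implicit Types (x : hplane R) (b : bool).

Lemma dotZr (c : R) (u v : R * R) : dot u (c *: v) = c * dot u v.
Proof. by rewrite pairZE /dot /=; ring. Qed.

(** The conformal factor is [2 / gap x]. At distance r from the origin the gap is 1 / cosh(r/2)^2,
    of order e^(-r). *)
Definition gap x : R := 1 - dot x x.

Lemma gap_gt0 x : 0 < gap x.
Proof. by rewrite subr_gt0 hcoordP. Qed.

Lemma gap_le1 x : gap x <= 1.
Proof. by have := dot_ge0 (hcoord x); rewrite /gap; lra. Qed.

(* At the origin every direction is normal to the radius. *)
Definition unit_normal (u : R * R) : R * R :=
  if dot u u == 0 then (1, 0) else (Num.sqrt (dot u u))^-1 *: (- u.2, u.1).

Lemma dot_unit_normal u : dot u (unit_normal u) = 0.
Proof.
rewrite /unit_normal; case: eqP => [/dot_eq0 ->|_]; first by rewrite /dot /=; ring.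
by rewrite dotZr /dot /=; ring.
Qed.

Lemma dot_unit_normal_self u : dot (unit_normal u) (unit_normal u) = 1.
Proof.
rewrite /unit_normal; case: eqP => [_|/eqP u0]; first by rewrite /dot /=; ring.
have uE : dot (- u.2, u.1) (- u.2, u.1) = dot u u by rewrite /dot /=; ring.
rewrite dotZ uE -{3}[dot u u]sqr_sqrtr ?dot_ge0 //; field.
by rewrite sqrtr_eq0 -ltNge lt_neqAle eq_sym u0 dot_ge0.
Qed.

(** The conformal factor [2 / gap x] turns this Euclidean length into the Riemannian length
    [gap x]. *)
Definition jump x : R * R := (gap x ^+ 2 / 2) *: unit_normal x.

Definition sjump b x : R * R := (-1) ^+ b *: jump x.

Definition step b x : hplane R := hexp x (sjump b x).

Lemma dot_sjump b x : dot (sjump b x) (sjump b x) = (gap x ^+ 2 / 2) ^+ 2.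
Proof.
by rewrite /sjump /jump !dotZ dot_unit_normal_self; case: b => /=; ring.
Qed.

Lemma sqrt_dot_sjump b x : Num.sqrt (dot (sjump b x) (sjump b x)) = gap x ^+ 2 / 2.
Proof. by rewrite dot_sjump sqrtr_sqr ger0_norm // divr_ge0 // sqr_ge0. Qed.

Lemma dot_coord_sjump b x : dot x (sjump b x) = 0.
Proof. by rewrite /sjump /jump !dotZr dot_unit_normal !mulr0. Qed.

Lemma riem_norm_sjump b x : riem_norm x (sjump b x) = gap x.
Proof.
rewrite riem_normE sqrt_dot_sjump /conformal -/(gap x); field.
by rewrite gt_eqF ?gap_gt0.
Qed.

Lemma hdist_step b x : hdist x (step b x) = gap x.
Proof. by rewrite /step hdist_hexp riem_norm_sjump. Qed.

Lemma hlog_step b x : hlog x (step b x) = sjump b x.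
Proof. exact: hlog_hexp. Qed.

Lemma d_tot_step b x : d_tot x (step b x) = gap x.
Proof. by rewrite /d_tot hlog_step riem_norm_sjump. Qed.

(** The geodesic from [x] to the origin starts along [- x], to which the jump is orthogonal. *)
Lemma d_rad_step b x : x != horigin -> d_rad x (step b x) = 0.
Proof.
move=> /negbTE x0; rewrite /d_rad x0 hlog_step /e_rad hlogE /hlog_formula.
have -> : mobius_add (- hcoord x) (@horigin R) = (-1) *: hcoord x.
  by rewrite scaleN1r mobius_add_coord /dot /=; congr (_, _); field.
rewrite !scalerA /riem dotZr.
have -> : dot (sjump b x) x = dot x (sjump b x) by rewrite /dot; ring.
by rewrite dot_coord_sjump !mulr0 oppr0.
Qed.

Lemma sjump_bounded b x :
  `|(sjump b x).1| <= 1 /\ `|(sjump b x).2| <= 1.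
Proof.
have g0 := gap_gt0 x; have g1 := gap_le1 x; have := dot_sjump b x.
have : (gap x ^+ 2 / 2) ^+ 2 <= 1 by rewrite expr_le1 //; nra.
move: (sjump b x) => [a c] /= h1 h2; move: h2 h1; rewrite /dot /= => <- h.
by split; rewrite -(@expr_le1 _ 2) // -normrX ger0_norm ?sqr_ge0 //; nra.
Qed.

(** Orthogonality kills the cross term in [mobius_add_dot], so the new gap depends on the old gap
    alone and not on the coin. *)
Lemma gap_step b x : gap (step b x) =
  gap x * (1 - tanh (gap x / 2) ^+ 2) /
    (1 + (1 - gap x) * tanh (gap x / 2) ^+ 2).
Proof.
set t := tanh (gap x / 2) ^+ 2.
rewrite [LHS]/gap /step /= /hexp_coord riem_norm_sjump sqrt_dot_sjump.
set v := _ *: sjump b x.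
have vv : dot v v = t.
  by rewrite /v dotZ dot_sjump /t; field; rewrite gt_eqF ?gap_gt0.
have xv : dot x v = 0.
  by rewrite /v dotZr dot_coord_sjump mulr0.
rewrite mobius_add_dot ?hcoordP ?vv ?xv ?tanh_sqr_lt1 //.
by rewrite /gap mulr0 addr0 opprB addrCA subrr addr0.
Qed.

(** With a = e^s and b = e^(-s), the claim reads b (1 + s/2) <= a (1 - s/2), and the bound e^s >= 1
    + s shows that 1 separates the two sides. *)
Lemma tanh_ge_half (s : R) : 0 <= s <= 1 -> s / 2 <= tanh s.
Proof.
move=> /andP[s0 s1]; rewrite /tanh.
have a1 : 1 + s <= expR s := expR_ge1Dx s.
have b0 := expR_gt0 (- s).
have ab : expR s * expR (- s) = 1 by rewrite expRN divff // gt_eqF ?expR_gt0.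
move: a1 b0 ab; set a := expR s; set b := expR (- s) => a1 b0 ab.
have b1 : b * (1 + s) <= 1 by rewrite -[leRHS]ab mulrC ler_pM2r.
have a2 : (1 + s) * (1 - s / 2) <= a * (1 - s / 2) by rewrite ler_pM2r //; lra.
have bs : 0 <= b * s by rewrite mulr_ge0 // ltW.
have ss : s * s <= s by nra.
by rewrite ler_pdivlMr; nra.
Qed.

(* The jumps shrink with the gap, but slowly enough for gap^-2 to grow at least
   linearly along every trajectory. *)
Lemma invr_sqr_gap_step b x :
  (gap x ^+ 2)^-1 + 8^-1 <= (gap (step b x) ^+ 2)^-1.
Proof.
have g0 := gap_gt0 x; have g1 := gap_le1 x; have h0 := gap_gt0 (step b x).
have /tanh_ge_half : 0 <= gap x / 2 <= 1 by apply/andP; split; lra.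
have t1 := tanh_sqr_lt1 (gap x / 2).
move: (gap_step b x) g0 g1 h0 t1; set h := gap (step b x); set g := gap x.
set t := tanh (g / 2) ^+ 2 => hE g0 g1 h0 t1 tg.
(* This is the square of [g / 4 <= tanh (g / 2)]. *)
have t0 : g ^+ 2 / 16 <= t.
  have -> : g ^+ 2 / 16 = (g / 2 / 2) ^+ 2 by field.
  by rewrite ler_sqr // nnegrE; lra.
have gg : 0 < g ^+ 2 by rewrite exprn_gt0.
(* The denominator in [gap_step] is at least 1. *)
have hg : h <= g * (1 - t).
  have p0 : 0 <= (1 - g) * t by rewrite mulr_ge0 ?sqr_ge0 // subr_ge0.
  rewrite hE ler_pdivrMr; last by lra.
  by apply: ler_peMr; [rewrite mulr_ge0 //; lra|lra].
have hg2 : h ^+ 2 <= g ^+ 2 * (1 - t) ^+ 2.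
  by rewrite -exprMn ler_sqr // nnegrE ?ltW //; exact: lt_le_trans h0 hg.
(* The left side is 1 - t^2 (3 - 2t). The constant 1/8 is chosen so that multiplying by [g ^+ 2]
   gives [1 + 2 * (g ^+ 2 / 16)], at most [1 + 2 * t]. *)
have e2 : (1 - t) ^+ 2 * (1 + 2 * t) <= 1 by nra.
rewrite -[leRHS]mul1r ler_pdivlMr ?exprn_gt0 //.
apply: (@le_trans _ _ (((g ^+ 2)^-1 + 8^-1) * (g ^+ 2 * (1 - t) ^+ 2))).
  by rewrite ler_pM2l // addr_gt0 // ?invr_gt0.
have -> : ((g ^+ 2)^-1 + 8^-1) * (g ^+ 2 * (1 - t) ^+ 2) =
    (1 - t) ^+ 2 * (1 + 2 * (g ^+ 2 / 16)).
  by field; rewrite gt_eqF.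
apply: le_trans e2; rewrite ler_pM2l ?exprn_gt0 //; lra.
Qed.

Lemma arcosh_bounds (c : R) : 1 <= c -> c <= expR (arcosh c) <= 2 * c.
Proof.
move=> c1; rewrite /arcosh; have s0 := sqrtr_ge0 (c ^+ 2 - 1).
have sc : Num.sqrt (c ^+ 2 - 1) <= c.
  rewrite -{2}[c]ger0_norm -?sqrtr_sqr ?ler_sqrt ?sqr_ge0 //; lra.
by rewrite lnK ?posrE; [apply/andP; split; lra|lra].
Qed.

(** The hyperbolic cosine of the distance is [2 / gap x - 1], which lies between [(gap x)^-1] and
    twice that because [gap x <= 1]. *)
Lemma hdist_origin_gap x :
  (gap x)^-1 <= expR (hdist horigin x) <= 4 * (gap x)^-1.
Proof.
have g0 := gap_gt0 x; have g1 := gap_le1 x; rewrite /hdist.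
have -> : dot (hcoord (@horigin R) - hcoord x) (hcoord (@horigin R) - hcoord x)
    = 1 - gap x by rewrite /gap /dot /=; ring.
have -> : 1 - dot (@horigin R) (@horigin R) = 1 by rewrite /dot /=; ring.
rewrite -/(gap x) mul1r; set c := 1 + _.
have cE : c = 2 * (gap x)^-1 - 1 by rewrite /c; field; rewrite gt_eqF.
have : 1 <= (gap x)^-1 by rewrite invf_ge1.
move=> i1; have /arcosh_bounds /andP[h1 h2] : 1 <= c by lra.
by apply/andP; split; lra.
Qed.

Lemma hdistC (x y : hplane R) : hdist x y = hdist y x.
Proof.
rewrite /hdist; congr arcosh.
have -> : dot (hcoord x - hcoord y) (hcoord x - hcoord y) =
  dot (hcoord y - hcoord x) (hcoord y - hcoord x) by rewrite /dot /=; ring.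
by rewrite [X in _ / X]mulrC.
Qed.

Lemma measurable_gap : measurable_fun setT gap.
Proof.
have mh := @measurable_hcoord R.
by apply: measurable_funB; [exact: measurable_cst|exact: measurable_dot].
Qed.

Lemma measurable_sjump b : measurable_fun setT (sjump b).
Proof.
have mh := @measurable_hcoord R.
apply: measurable_pairZ; first exact: measurable_cst.
apply: measurable_pairZ.
  by apply: measurable_funM; [exact/measurable_funX/measurable_gap|exact: measurable_cst].
rewrite /unit_normal; apply: measurable_fun_ifT; last first.
- apply: measurable_pairZ.
    by apply: measurable_funV; apply: measurable_fun_sqrt; exact: measurable_dot.
  apply: measurable_fun_pair; last exact: measurable_fun1.
  by apply: measurable_funN; exact: measurable_fun2.
- exact: measurable_cst.
- by apply: measurable_fun_eqr; [exact: measurable_dot|exact: measurable_cst].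
Qed.

Lemma measurable_step b : measurable_fun setT (step b).
Proof. exact/measurable_hexp/measurable_sjump. Qed.

End TangentialStep.

(** * Jump moments and radial decay of the tangential walk *)

Section TangentialWalk.
Context {R : realType}.

Definition step_kernel : R.-pker (hplane R) ~> (hplane R) :=
  coin_kernel R (@measurable_step R).

Lemma step_kernel_bounded_jump_moments : bounded_jump_moments step_kernel.
Proof.
(* Jumps have length [gap x <= 1], so any exponent above 2 works with the bound 1. *)
exists 3, 1; split; first by lra.
move=> x; rewrite integral_coin_kernel; last first.
  apply: (measurableT_comp (f := fun t : R => t `^ 3)); first exact: measurable_powR.
  rewrite (_ : hdist x = d_tot x); first exact: measurable_d_tot.
  by apply/funext => y; rewrite /d_tot riem_norm_hlog.
have g3 : gap x `^ 3 <= 1.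
  have := @ge0_ler_powR R 3 (ler0n _ 3) (gap x) 1; rewrite powR1; apply;
    by rewrite ?nnegrE ?gap_le1 ?ler01 // ltW ?gap_gt0.
by rewrite !hdist_step lee_fin; lra.
Qed.

Lemma E_jump_step_kernel (x : hplane R) : x != horigin ->
  E_jump step_kernel x (fun dtot drad => dtot ^+ 2 - drad ^+ 2) =
  (gap x ^+ 2)%:E.
Proof.
move=> x0; rewrite /E_jump integral_coin_kernel; last first.
  by apply: measurable_funB; apply: measurable_funX;
    [exact: measurable_d_tot|exact: measurable_d_rad].
by rewrite !d_tot_step !d_rad_step //; congr EFin; field.
Qed.

Lemma hsphere_nonempty (r : R) : 0 < r -> exists x, hsphere r x.
Proof.
(* The conformal factor at the origin is 2, hence the half. *)
move=> r0; exists (hexp horigin (r / 2, 0)); rewrite /hsphere /= hdist_hexp.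
rewrite riem_normE /conformal (_ : dot (r / 2, 0) (r / 2, 0) = (r / 2) ^+ 2); last first.
  by rewrite /dot /=; ring.
rewrite sqrtr_sqr ger0_norm ?divr_ge0 // ?ltW //.
by rewrite /dot /= !mulr0 addr0 subr0; field.
Qed.

Lemma hsphere_neq_origin (r : R) x : 0 < r -> hsphere r x -> x != horigin.
Proof.
move=> r0 xr; apply/eqP => xO; move: r0; rewrite -xr xO /hdist subrr.
rewrite {1}/dot /= !mulr0 addr0 mulr0 mul0r addr0.
by rewrite /arcosh expr1n subrr sqrtr0 addr0 ln1 ltxx.
Qed.

(** The squared gap is at most 16 e^(-r), and the exponential series bounds r^(N+1) by (N+1)! e^r;
    the extra power of r yields the factor [r^-1]. *)
Lemma expr_gap_sqr_le (N : nat) (r : R) x : 0 < r -> hsphere r x ->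
  r ^+ N * gap x ^+ 2 <= 16 * (N.+1)`!%:R * r^-1.
Proof.
move=> r0 xr; have := hdist_origin_gap x; rewrite (xr : hdist horigin x = r).
move=> /andP[_ gr]; have g0 := gap_gt0 x; have g1 := gap_le1 x.
have e0 := expR_gt0 r.
have ge : gap x * expR r <= 4 by rewrite mulrC -ler_pdivlMr.
have g2 : gap x ^+ 2 * expR r <= 16 by rewrite expr2; nra.
have f0 : 0 < (N.+1)`!%:R :> R by rewrite ltr0n fact_gt0.
have re : r ^+ N.+1 <= (N.+1)`!%:R * expR r.
  rewrite -ler_pdivrMl // mulrC.
  by have := expR_ge1Dxn N (ltW r0); lra.
rewrite ler_pdivlMr // mulrAC -exprSr.
apply: (@le_trans _ _ ((N.+1)`!%:R * expR r * gap x ^+ 2)).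
  by rewrite ler_pM2r // exprn_gt0.
have -> : (N.+1)`!%:R * expR r * gap x ^+ 2 = (gap x ^+ 2 * expR r) * (N.+1)`!%:R.
  by ring.
by rewrite ler_pM2r.
Qed.

Lemma step_kernel_radial (N : nat) :
  ((r ^+ N)%:E *
     ereal_sup [set E_jump step_kernel x
       (fun dtot drad => (dtot ^+ 2 - drad ^+ 2)%R) | x in hsphere r])%E
    @[r --> +oo%R] --> 0%E.
Proof.
apply: (@squeeze_cvge _ _ _ _ (fun=> 0%E) _
  (fun r => (16 * (N.+1)`!%:R * r^-1)%:E)); first last.
- apply: cvg_EFin; first by near=> r.
  rewrite -[0 in X in _ --> X](mulr0 (16 * (N.+1)`!%:R)).
  apply: cvgMr; apply/gtr0_cvgV0; last exact: cvg_id.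
  by near=> r; near: r; exact: nbhs_pinfty_gt.
- exact: cvg_cst.
near=> r.
have r0 : 0 < r by near: r; exact: nbhs_pinfty_gt.
have rN : 0 < r ^+ N by rewrite exprn_gt0.
have jumpE x : hsphere r x ->
    E_jump step_kernel x (fun dtot drad => dtot ^+ 2 - drad ^+ 2) = (gap x ^+ 2)%:E.
  by move=> xr; apply: E_jump_step_kernel; exact: hsphere_neq_origin xr.
apply/andP; split.
  apply: mule_ge0; first by rewrite lee_fin ltW.
  (* A point of the sphere is needed, the supremum of the empty set being minus infinity. *)
  have [x xr] := hsphere_nonempty r0.
  apply: (@le_trans _ _ (gap x ^+ 2)%:E); first by rewrite lee_fin sqr_ge0.
  by apply: ereal_sup_ubound; exists x => //; exact: jumpE.
rewrite muleC -lee_pdivlMr // -EFinM.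
apply: ge_ereal_sup => _ [x xr <-]; rewrite jumpE // lee_fin ler_pdivlMr // mulrC.
exact: expr_gap_sqr_le.
Unshelve. all: by end_near. Qed.

End TangentialWalk.

(** Summing the increments of at least 1/8 gives gap^(-2) >= n/8 for every coin sequence, and the
    exponential of the distance dominates gap^(-1). *)
Lemma step_walk_diverges (R : realType) (xi : nat -> bool) (x : nat -> hplane R) :
  (forall n, x n.+1 = step (xi n) (x n)) ->
  hdist horigin (x n) @[n --> \oo] --> +oo.
Proof.
move=> xS; have gn n : n%:R / 8 <= (gap (x n) ^+ 2)^-1.
  elim: n => [|n IH]; first by rewrite mul0r invr_ge0 sqr_ge0.
  have := invr_sqr_gap_step (xi n) (x n); rewrite xS -[n.+1%:R]natr1; lra.
apply/cvgryPge => A; near=> n.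
have nA : 8 * expR A ^+ 2 <= n%:R by near: n; exact: nbhs_infty_ger.
have /andP[h _] := hdist_origin_gap (x n).
have g0 : 0 < (gap (x n))^-1 by rewrite invr_gt0 gap_gt0.
rewrite -ler_expR; apply: le_trans h.
rewrite -ler_sqr ?nnegrE ?expR_ge0 ?(ltW g0) // exprVn.
apply: le_trans (gn n); lra.
Unshelve. all: by end_near. Qed.

Theorem proposition6p4 (R : realType) :
  exists K : R.-pker (hplane R) ~> (hplane R),
    bounded_jump_moments K /\
    (forall x0 : hplane R,
      exists (d : measure_display) (Omega : measurableType d)
             (P : probability Omega R) (X : nat -> {RV P >-> hplane R}),
        [/\ markov_chain K X, started_at x0 X, zero_drift X,
            transient X & non_confined X]) /\
    (forall N : nat, (0 < N)%N ->
      ((r ^+ N)%:E *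
         ereal_sup [set E_jump K x (fun dtot drad => (dtot ^+ 2 - drad ^+ 2)%R)
                   | x in hsphere r])%E
        @[r --> +oo%R] --> 0%E).
Proof.
exists step_kernel; split; first exact: step_kernel_bounded_jump_moments.
split; last by move=> N _; exact: step_kernel_radial.
move=> x0; have := exists_coin_walk measurable_step x0.
move=> [d] [T] [P] [xi] [X] [X0 XS Xcond].
have Xoo w : hdist horigin (X n w) @[n --> \oo] --> +oo.
  exact: (step_walk_diverges (xi := fun n => xi n w)).
exists d, T, P, X; split.
- move=> n A mA.
  (* Markov property: the average of the indicator over the two successors is the kernel's mass of
     [A]. *)
  have := Xcond n (fun b x => \1_A (step b x)) 1.
  rewrite (_ : (fun w => \1_A (step (xi n w) (X n w))) =
      (fun w => \1_A (X n.+1 w))); last by apply/funext => w; rewrite XS.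
  rewrite (_ : (fun w => 2^-1 * _) = (fun w => fine (step_kernel (X n w) A)));
    last by apply/funext => w; rewrite coin_kernelE.
  apply=> [b|b x]; last by rewrite indicE; case: (_ \in _); rewrite ?normr1 ?normr0.
  apply: (measurableT_comp (f := \1_A : _ -> R)); first exact: measurable_indic.
  exact: measurable_step.
- by apply: aeW => w; rewrite X0.
(* An odd function of the jump averages to zero over the two opposite jumps; both coordinates are
   such functions. *)
- have drift (c : R * R -> R) n : (forall u, c (- u) = - c u) ->
      measurable_fun setT c -> (forall b (x : hplane R), `|c (sjump b x)| <= 1) ->
      is_cond_expectation P (natural_filtration X n)
        (fun w => c (hlog (X n w) (X n.+1 w))) (cst 0).
    move=> cN mc c1; have := Xcond n (fun b x => c (sjump b x)) 1.
    rewrite (_ : (fun w => c (sjump _ _)) =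
      (fun w => c (hlog (X n w) (X n.+1 w)))); last first.
      by apply/funext => w; rewrite XS hlog_step.
    rewrite (_ : (fun w => 2^-1 * _) = cst 0); last first.
      apply/funext => w; rewrite /sjump expr1 expr0 scaleN1r scale1r cN /=; ring.
    apply=> // b; apply: measurableT_comp mc _; exact: measurable_sjump.
  move=> n; split.
    by apply: (drift fst) => // b x; have [] := sjump_bounded b x.
  by apply: (drift snd) => // b x; have [] := sjump_bounded b x.
- by apply: aeW => w; exact: Xoo.
- apply: aeW => w; have /cvgeryP h := Xoo w.
  under eq_fun do rewrite hdistC.
  by have [_ ->] := cvg_limn_einf_sup h.
Qed.
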